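(* Let $f_{i,t}$, $i\in\mathcal V=\{1,\dots,m\}$, $t\ge1$, be generated by the distributed functional gradient descent (DFGD) algorithm described in the context on a real Hilbert space $\mathcal H$, where: (i) the network satisfies the graph assumption: each $P_t$ is doubly stochastic; there is an integer $B\ge1$ such that the graph $(\mathcal V,\mathcal E_{kB+1}\cup\cdots\cup\mathcal E_{(k+1)B})$ is strongly connected for every $k\ge0$; and there is $0<\zeta<1$ with $[P_t]_{ii}\ge\zeta$ for all $i,t$ and $[P_t]_{ij}\ge\zeta$ whenever $(j,i)\in\mathcal E_t$; (ii) there is a constant $G$ with $\|\mathbf D_f\mathbf J_i\|_{\mathcal H}\le G$ for all $f\in\mathcal H$, $i\in\mathcal V$; (iii) each $\mathbf J_i$, $i\in\mathcal V$, is Fréchet differentiable on $\mathcal H$ and $L$-smooth (as defined in the context). For a total number of iterations $T\ge1$ let the stepsize be $\eta=\frac{1}{2L\sqrt{T+3}}$. Then for any $\ell\in\mathcal V$, $$\frac1T\sum_{t=1}^T\|\mathbf D_{f_{\ell,t}}\mathbf J\|_{\mathcal H}^2\le\mathcal O\Big(\frac1{\sqrt T}\Big).$$ Moreover, when the global functional $\mathbf J$ satisfies the $\mu$-Polyak-Łojasiewicz condition, i.e. for some constant $\mu>0$, $\frac12\|\mathbf D_f\mathbf J\|_{\mathcal H}^2\ge\mu(\mathbf J(f)-\mathbf J(f^* ))$ for all $f\in\mathcal H$, then for any $\ell\in\mathcal V$, $$\frac1T\sum_{t=1}^T\big[\mathbf J(f_{\ell,t})-\mathbf J(f^* )\big]\le\mathcal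 O\Big(\frac1{\sqrt T}\Big).$$ Here $\mathcal O(1/\sqrt T)$ means bounded by $C/\sqrt T$ for all $T\ge1$ with a constant $C>0$ independent of $T$ (the initial points $f_{i,1}$ being fixed independently of $T$).
   Context: $\mathcal H$ is a real Hilbert space with inner product $\langle\cdot,\cdot\rangle_{\mathcal H}$, identified with its dual by the Riesz representation theorem. The local functionals $\mathbf J_i:\mathcal H\to\mathbb R$, $i\in\mathcal V$, can be nonconvex; $\mathbf J=\sum_{i=1}^m\mathbf J_i$. $f^*\in\mathcal H$ denotes a global minimizer of $\mathbf J$ on $\mathcal H$, assumed to exist. For a Fréchet differentiable functional $\mathbf F$, $\mathbf D_f\mathbf F$ denotes its Fréchet derivative at $f$, regarded as an element of $\mathcal H$. Subgradients: for a functional $\mathbf F:\mathcal H\to\mathbb R$ and $f_0\in\mathcal H$, the set of subgradients at $f_0$ is $\partial_{f_0}\mathbf F=\{g\in\mathcal H:\ \mathbf F(f)-\mathbf F(f_0)\ge\langle f-f_0,g\rangle_{\mathcal H}\ \text{for all } f\in\mathcal H\}$. $L$-smoothness: a functional $\mathbf F$ is $L$-smooth if for all $f_0\in\mathcal H$ there exists $g\in\partial_{f_0}\mathbf F$ such that $\mathbf F(f)-\mathbf F(f_0)\le\langle f-f_0,g\rangle_{\mathcal H}+\frac L2\|f-f_0\|_{\mathcal H}^2$ for all $f\in\mathcal H$. Network: for each $t\ge1$, $P_t$ is an $m\times m$ matrix with nonnegative entries $[P_t]_{ij}$, and $\mathcal E_t=\{(j,i)\in\mathcal V\times\mathcal V:[P_t]_{ij}>0\}$.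 DFGD algorithm with constant stepsize $\eta>0$ and initial points $f_{i,1}\in\mathcal H$: for $t\ge1$, $i\in\mathcal V$, $h_{i,t}=f_{i,t}-\eta\,\mathbf D_{f_{i,t}}\mathbf J_i$ and $f_{i,t+1}=\sum_{j=1}^m[P_t]_{ij}h_{j,t}$. *)

(* Defs.v *)
From HB Require Import structures.
From mathcomp Require Import all_boot all_order all_algebra.
From mathcomp Require Import all_classical all_reals all_analysis.

Set Implicit Arguments.
Unset Strict Implicit.
Unset Printing Implicit Defensive.

Import Order.TTheory GRing.Theory Num.Theory.
Import numFieldNormedType.Exports.

Local Open Scope ring_scope.

(* A real Hilbert space is a complete normed space [H] together with a
   symmetric positive definite bilinear form [ip : {dot H for idfun}] that
   induces the norm of [H]. *)
Definition induces_norm (R : realType) (H : completeNormedModType R)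
    (ip : {dot H for idfun}) : Prop :=
  forall x : H, `|x| = Num.sqrt (ip x x).

(* The Riesz representative of the Fréchet derivative of [F] at [f]; it is
   unique when it exists, and it exists when [F] is differentiable at [f].
   [xget] returns the default value [0] otherwise. *)
Definition gradient (R : realType) (H : completeNormedModType R)
    (ip : {dot H for idfun}) (F : H -> R) (f : H) : H :=
  xget 0 [set g : H | forall h : H, 'd F f h = ip h g]%classic.

Definition subgradients (R : realType) (H : completeNormedModType R)
    (ip : {dot H for idfun}) (F : H -> R) (f0 : H) : set H :=
  [set g : H | forall f : H, F f - F f0 >= ip (f - f0) g]%classic.

Definition smooth (R : realType) (H : completeNormedModType R)
    (ip : {dot H for idfun}) (L : R) (F : H -> R) : Prop :=
  forall f0 : H, exists2 g : H, subgradients ip F f0 g &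
    forall f : H, F f - F f0 <= ip (f - f0) g + L / 2 * `|f - f0| ^+ 2.

Definition global_functional (R : realType) (H : completeNormedModType R)
    (m : nat) (J : 'I_m -> H -> R) : H -> R :=
  fun f => \sum_(i < m) J i f.

Definition polyak_lojasiewicz (R : realType) (H : completeNormedModType R)
    (ip : {dot H for idfun}) (mu : R) (F : H -> R) (fstar : H) : Prop :=
  forall f : H, 2^-1 * `|gradient ip F f| ^+ 2 >= mu * (F f - F fstar).

Definition doubly_stochastic (R : realType) (m : nat) (A : 'M[R]_m) : Prop :=
  [/\ forall i j, 0 <= A i j,
      forall i, \sum_(j < m) A i j = 1 &
      forall j, \sum_(i < m) A i j = 1].

(* Node [j] sends to node [i]: the edge goes from the column to the row. *)
Definition edge (R : realType) (m : nat) (A : 'M[R]_m) : rel 'I_m :=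
  fun j i => 0 < A i j.

(* The union of the edge sets at the times k B + 1, ..., (k + 1) B. *)
Definition union_edge (R : realType) (m : nat) (P : nat -> 'M[R]_m)
    (B k : nat) : rel 'I_m :=
  fun j i => has (fun t => edge (P t) j i)
                 (index_iota (k * B).+1 (k.+1 * B).+1).

Definition strongly_connected (m : nat) (e : rel 'I_m) : Prop :=
  forall i j : 'I_m, connect e i j.

(* Times start at 1; the value [P 0] is irrelevant. *)
Definition graph_assumption (R : realType) (m : nat) (P : nat -> 'M[R]_m)
    (B : nat) (zeta : R) : Prop :=
  [/\ forall t : nat, (1 <= t)%N -> doubly_stochastic (P t),
      (1 <= B)%N /\
      (forall k : nat, strongly_connected (union_edge P B k)),
      0 < zeta < 1,
      forall (t : nat) (i : 'I_m), (1 <= t)%N -> zeta <= P t i i &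
      forall (t : nat) (i j : 'I_m), (1 <= t)%N ->
        edge (P t) j i -> zeta <= P t i j].

(* [f t i] is the iterate of node [i] at time [t]; times start at 1 and the
   value [f 0] is irrelevant. *)
Definition is_dfgd (R : realType) (H : completeNormedModType R)
    (ip : {dot H for idfun}) (m : nat) (J : 'I_m -> H -> R)
    (P : nat -> 'M[R]_m) (eta : R) (f1 : 'I_m -> H)
    (f : nat -> 'I_m -> H) : Prop :=
  (forall i : 'I_m, f 1%N i = f1 i) /\
  (forall (t : nat) (i : 'I_m), (1 <= t)%N ->
     f t.+1 i =
       \sum_(j < m) P t i j *: (f t j - eta *: gradient ip (J j) (f t j))).

Definition stepsize (R : realType) (L : R) (T : nat) : R :=
  (2 * L * Num.sqrt (T + 3)%:R)^-1.

(* Main.v *)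
Require Import Defs.
From HB Require Import structures.
From mathcomp Require Import all_boot all_order all_algebra.
From mathcomp Require Import all_classical all_reals all_analysis.
From mathcomp Require Import zify ring lra.

Import Order.TTheory GRing.Theory Num.Theory.
Import numFieldNormedType.Exports.

Local Open Scope ring_scope.

(** The smoothness hypothesis provides a global subgradient at every point. A
    subgradient of a differentiable functional can only be its gradient
    ([gradient_subgradient]), so each local functional is convex with a
    quadratic upper bound, and its gradient is [L]-Lipschitz
    ([gradient_lipschitz]). All this passes to the sum over the nodes, with
    constant [m * L]; in particular the gradient of the sum is the sum of the
    gradients ([gradient_global]).

    The network averages: mixing by a doubly stochastic matrix preserves the
    mean of the iterates. The disagreement, that is the sum of the distances
    to the mean, never increases under mixing, and it contracts by a fixed
    factor [q < 1] when all the weights are bounded below by a positive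
    constant ([disagreement_mix]). Strong connectivity over blocks of length
    [B] makes the product of any [W = 2 * B * m] consecutive weight matrices
    such a matrix, with lower bound [zeta ^+ W] ([transition_lower_bound]):
    every [2 * B] steps at least one new node hears from a given source, until
    all have. Each
    gradient step creates a disagreement of order [eta] only, because the
    gradients are bounded; hence the disagreements up to time [T] sum to at
    most [K1 + K2 * eta * T] ([sum_disagreement_dfgd]).

    The mean itself follows an inexact gradient descent on the global
    functional, whose error is controlled by the disagreement
    ([mean_descent]). Telescoping, and comparing the gradient at the mean with
    the gradient at a node, bounds the sum of the squared gradients by
    [A / eta + M * (sum of disagreements) + N * eta * T]. As [eta] has order
    [1 / sqrt T], dividing by [T] gives the rate ([rate_arith],
    [gradient_rate]). Under the Polyak-Lojasiewicz condition the optimality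
    gap is at most the squared gradient over [2 * mu], so it obeys the same
    rate. *)

Set Implicit Arguments.
Unset Strict Implicit.
Unset Printing Implicit Defensive.

(** * Inner products, subgradients and smoothness *)

(** The real arithmetic of the Lipschitz bound for gradients: the three
    hypotheses are the lower bound at [y] evaluated at [z], the upper bound at
    [x] evaluated at [z], and the upper bound at [y] evaluated at [x]. *)
Lemma bregman_arith (R : realFieldType) (L a b c d r Fx Fy Fz : R) :
  0 < L -> a - L^-1 * b <= Fz - Fy ->
  Fz - Fx <= - (L^-1 * c) + L / 2 * (L^-1 * d) ^+ 2 ->
  Fx - Fy <= a + L / 2 * r ^+ 2 -> c - b = d ^+ 2 -> d ^+ 2 <= (L * r) ^+ 2.
Proof.
move=> L0 low upz upx cb.
have e : L / 2 * (L^-1 * d) ^+ 2 = L^-1 * d ^+ 2 / 2 by field; lra.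
have : L^-1 * d ^+ 2 <= L * r ^+ 2 by rewrite e in upz; rewrite -cb in upz *; lra.
by rewrite mulrC ler_pdivrMr// exprMn; lra.
Qed.

Section InnerProduct.
Context (R : realType) (H : completeNormedModType R) (ip : {dot H for idfun}).
Hypothesis Hip : induces_norm ip.

Lemma ipC x y : ip x y = ip y x.
Proof. by rewrite hermC /= expr0 mul1r. Qed.

Lemma ipDl x y z : ip (x + y) z = ip x z + ip y z.
Proof. exact: linearDl. Qed.

Lemma ipNl x z : ip (- x) z = - ip x z.
Proof. exact: linearNl. Qed.

Lemma ipZl a x z : ip (a *: x) z = a * ip x z.
Proof. exact: linearZl_LR. Qed.

Lemma ipDr x y z : ip z (x + y) = ip z x + ip z y.
Proof. by rewrite ipC ipDl !(ipC z). Qed.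

Lemma ipNr x z : ip z (- x) = - ip z x.
Proof. by rewrite ipC ipNl ipC. Qed.

Lemma ipZr a x z : ip z (a *: x) = a * ip z x.
Proof. by rewrite ipC ipZl ipC. Qed.

Lemma ip_sumr I (r : seq I) (x : H) (F : I -> H) :
  ip x (\sum_(i <- r) F i) = \sum_(i <- r) ip x (F i).
Proof. exact: raddf_sum. Qed.

Lemma ipxx x : ip x x = `|x| ^+ 2.
Proof.
rewrite Hip sqr_sqrtr//; have [->|x0] := eqVneq x 0.
  by rewrite -(scale0r x) ipZl mul0r.
exact/ltW/neq0_dnorm_gt0.
Qed.

(** Both the norm and the form are at hand, so the Cauchy-Schwarz inequality
    is the triangle inequality for [|x + y|], squared and expanded. *)
Lemma ip_le x y : ip x y <= `|x| * `|y|.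
Proof.
have : `|x + y| ^+ 2 <= (`|x| + `|y|) ^+ 2.
  by rewrite ler_pXn2r ?nnegrE ?addr_ge0// ler_normD.
rewrite -ipxx ipDl !ipDr (ipC y x) !ipxx; nra.
Qed.

(** Only the right half of the limit that defines the derivative is used: it
    turns the subgradient inequality into [ip h g <= 'd F f0 h], and linearity
    of both sides in [h] upgrades this to an equality. *)
Lemma diff_subgradient (F : H -> R) (f0 g : H) :
  differentiable F f0 -> subgradients ip F f0 g ->
  forall h, 'd F f0 h = ip h g.
Proof.
move=> dF sg.
have le_d h : ip h g <= 'd F f0 h.
  rewrite -deriveE//; have := @diff_derivable _ _ _ _ _ h dF.
  rewrite /derivable /derive => /cvg_ex [l Fl].
  rewrite (cvg_lim _ Fl)//.
  have Fr := cvg_dnbhs_at_right Fl.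
  rewrite -(cvg_lim _ Fr)//; apply: limr_ge; first by apply/cvg_ex; exists l.
  near=> t; have t0 : 0 < t by near: t; exact: nbhs_right_gt.
  (* scaling in [R] is multiplication *)
  rewrite -[_ *: _]/(t^-1 * _) mulrC ler_pdivlMr// mulrC -ipZl.
  by have := sg (t *: h + f0); rewrite addrK.
move=> h; apply/eqP; rewrite eq_le le_d andbT.
by have := le_d (- h); rewrite ipNl linearN lerN2.
Unshelve. all: by end_near.
Qed.

(** Positive definiteness makes the Riesz representative unique, so any
    representative is the one chosen by [gradient]. *)
Lemma gradientE (F : H -> R) (f g : H) :
  (forall h, 'd F f h = ip h g) -> gradient ip F f = g.
Proof.
move=> dFg; apply: xget_unique => // g' dFg'.
apply/eqP; rewrite -subr_eq0 -normr_eq0 -sqrf_eq0 -ipxx.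
by rewrite ipDr ipNr -dFg -dFg' subrr.
Qed.

Lemma gradient_subgradient (F : H -> R) (f g : H) :
  differentiable F f -> subgradients ip F f g -> gradient ip F f = g.
Proof. by move=> dF sg; apply/gradientE/diff_subgradient. Qed.

Section ConvexSmooth.
Context (F : H -> R) (L : R).
Hypothesis dF : forall f, differentiable F f.
Hypothesis smF : smooth ip L F.

Lemma gradient_lower f f0 : ip (f - f0) (gradient ip F f0) <= F f - F f0.
Proof. by have [g sg _] := smF f0; rewrite (gradient_subgradient (dF f0) sg). Qed.

Lemma gradient_upper f f0 :
  F f - F f0 <= ip (f - f0) (gradient ip F f0) + L / 2 * `|f - f0| ^+ 2.
Proof. by have [g sg] := smF f0; rewrite (gradient_subgradient (dF f0) sg). Qed.

(** With [d] the difference of the two gradients, the lower bound at [y] and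
    the upper bound at [x] are compared at the point [x - d / L], which
    minimizes the upper bound tilted by the gradient at [y]; what remains is
    [|d| ^ 2 / (2 L) <= L / 2 * |x - y| ^ 2]. *)
Lemma gradient_lipschitz (L0 : 0 < L) x y :
  `|gradient ip F x - gradient ip F y| <= L * `|x - y|.
Proof.
set gx := gradient ip F x; set gy := gradient ip F y; set d := gx - gy.
rewrite -(@ler_pXn2r _ 2)// ?nnegrE// ?mulr_ge0 ?(ltW L0)//.
set z := x - L^-1 *: d.
have zx : z - x = - (L^-1 *: d) by rewrite /z addrAC subrr sub0r.
have zy : z - y = (x - y) - L^-1 *: d by rewrite /z addrAC.
have low := gradient_lower z y; have upz := gradient_upper z x.
have upx := gradient_upper x y.
rewrite zy ipDl ipNl ipZl in low.
rewrite zx ipNl ipZl normrN normrZ gtr0_norm ?invr_gt0// in upz.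
apply: (bregman_arith L0 low upz upx).
by rewrite -/gx -/gy -ipxx ipDr ipNr.
Qed.

End ConvexSmooth.

Section Sum.
Context (m : nat) (J : 'I_m -> H -> R) (L : R).
Hypothesis dJ : forall i f, differentiable (J i) f.
Hypothesis smJ : forall i, smooth ip L (J i).

Lemma differentiable_global f : differentiable (global_functional J) f.
Proof.
rewrite (_ : global_functional J = \sum_(i < m) J i).
  exact: differentiable_sum.
by apply/funext => x; rewrite /global_functional fct_sumE.
Qed.

Lemma subgradients_global f :
  subgradients ip (global_functional J) f (\sum_(i < m) gradient ip (J i) f).
Proof.
move=> h /=; rewrite /global_functional -sumrB ip_sumr; apply: ler_sum => i _.
exact: gradient_lower.
Qed.

Lemma gradient_global f :
  gradient ip (global_functional J) f = \sum_(i < m) gradient ip (J i) f.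
Proof.
exact: gradient_subgradient (differentiable_global f) (subgradients_global f).
Qed.

Lemma smooth_global : smooth ip (m%:R * L) (global_functional J).
Proof.
move=> f; exists (\sum_(i < m) gradient ip (J i) f).
  exact: subgradients_global.
move=> h; rewrite /global_functional -sumrB ip_sumr.
have -> : m%:R * L / 2 * `|h - f| ^+ 2 = \sum_(i < m) (L / 2 * `|h - f| ^+ 2).
  by rewrite sumr_const card_ord -mulr_natl; ring.
by rewrite -big_split; apply: ler_sum => i _; exact: gradient_upper.
Qed.

End Sum.
End InnerProduct.

(** * Mixing by doubly stochastic matrices *)

Section Averaging.
Context (R : realType) (V : normedModType R) (m : nat).
Implicit Types (x y : 'I_m -> V) (A B : 'M[R]_m).

Definition mean x : V := m%:R^-1 *: \sum_(j < m) x j.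

Definition disagreement x : R := \sum_(j < m) `|x j - mean x|.

Definition mix A x : 'I_m -> V := fun i => \sum_(j < m) A i j *: x j.

Lemma disagreement_ge0 x : 0 <= disagreement x.
Proof. exact: sumr_ge0. Qed.

Lemma norm_sub_mean_le x j : `|x j - mean x| <= disagreement x.
Proof. by rewrite /disagreement (bigD1 j)//= lerDl sumr_ge0. Qed.

Lemma meanD x y : mean (fun j => x j + y j) = mean x + mean y.
Proof. by rewrite /mean big_split scalerDr. Qed.

Lemma disagreementD x y :
  disagreement (fun j => x j + y j) <= disagreement x + disagreement y.
Proof.
rewrite /disagreement -big_split; apply: ler_sum => j _ /=.
by rewrite meanD opprD addrACA ler_normD.
Qed.

Lemma sum_sub_mean x : \sum_(j < m) (x j - mean x) = 0.
Proof.
rewrite sumrB sumr_const card_ord /mean -scaler_nat scalerA.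
have [m0|m0] := eqVneq m 0%N; last by rewrite divff ?scale1r ?subrr// pnatr_eq0.
by rewrite big1 ?scaler0 ?subrr// => -[j jm] _; exfalso; rewrite m0 in jm.
Qed.

Lemma norm_mean_le x c : 0 <= c -> (forall j, `|x j| <= c) -> `|mean x| <= c.
Proof.
move=> c0 xc; have [m0|m0] := eqVneq m 0%N.
  by rewrite /mean big1 ?scaler0 ?normr0// => -[j jm] _; exfalso; rewrite m0 in jm.
rewrite /mean normrZ ger0_norm ?invr_ge0// mulrC ler_pdivrMr ?ltr0n ?lt0n//.
rewrite (le_trans (ler_norm_sum _ _ _))// (le_trans (ler_sum _ (fun j _ => xc j)))//.
by rewrite sumr_const card_ord mulr_natr.
Qed.

Lemma disagreement_le x c :
  0 <= c -> (forall j, `|x j| <= c) -> disagreement x <= 2 * m%:R * c.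
Proof.
move=> c0 xc; have -> : 2 * m%:R * c = \sum_(j < m) (c + c).
  by rewrite sumr_const card_ord -mulr_natl; ring.
apply: ler_sum => j _; rewrite (le_trans (ler_normB _ _))// lerD//.
exact: norm_mean_le.
Qed.

Lemma mean_mix A x : doubly_stochastic A -> mean (mix A x) = mean x.
Proof.
move=> [_ _ colA]; rewrite /mean /mix exchange_big; congr (_ *: _).
by apply: eq_bigr => j _; rewrite -scaler_suml colA scale1r.
Qed.

(** The deviations from the mean sum to zero, so subtracting the constant
    [delta] from every weight leaves the mixed deviations unchanged; the
    weights that remain are nonnegative, and by column-stochasticity each
    deviation is then counted with total weight [1 - m * delta]. *)
Lemma disagreement_mix A x (delta : R) :
  doubly_stochastic A -> (forall i j, delta <= A i j) ->
  disagreement (mix A x) <= (1 - m%:R * delta) * disagreement x.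
Proof.
move=> dsA dA; have [_ rowA colA] := dsA.
have dev i : mix A x i - mean (mix A x) =
    \sum_(j < m) (A i j - delta) *: (x j - mean x).
  rewrite mean_mix//.
  transitivity (\sum_(j < m) A i j *: (x j - mean x)).
    rewrite (eq_bigr (fun j => A i j *: x j - A i j *: mean x)); last first.
      by move=> j _; rewrite scalerBr.
    by rewrite sumrB -scaler_suml rowA scale1r.
  under [RHS]eq_bigr do rewrite scalerBl.
  by rewrite sumrB -scaler_sumr sum_sub_mean scaler0 subr0.
apply: (@le_trans _ _ (\sum_(i < m) \sum_(j < m) (A i j - delta) * `|x j - mean x|)).
  apply: ler_sum => i _; rewrite dev (le_trans (ler_norm_sum _ _ _))//.
  by apply: ler_sum => j _; rewrite normrZ ger0_norm// subr_ge0.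
rewrite exchange_big mulr_sumr; apply: ler_sum => j _.
by rewrite -mulr_suml sumrB colA sumr_const card_ord mulr_natl.
Qed.

Lemma disagreement_mix_le A x :
  doubly_stochastic A -> disagreement (mix A x) <= disagreement x.
Proof.
move=> dsA; have [A0 _ _] := dsA.
by have := disagreement_mix x dsA A0; rewrite mulr0 subr0 mul1r.
Qed.

Lemma mix1 x : mix 1%:M x = x.
Proof.
apply/funext => i; rewrite /mix (bigD1 i)//= mxE eqxx scale1r big1 ?addr0//.
by move=> j /negPf ji; rewrite mxE eq_sym ji scale0r.
Qed.

Lemma mixM A B x : mix (A *m B) x = mix A (mix B x).
Proof.
apply/funext => i; rewrite /mix.
under eq_bigr do rewrite mxE scaler_suml.
rewrite exchange_big; apply: eq_bigr => j _; rewrite scaler_sumr.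
by apply: eq_bigr => k _; rewrite scalerA.
Qed.

Lemma mixD A x y : mix A (fun j => x j + y j) = fun i => mix A x i + mix A y i.
Proof.
apply/funext => i; rewrite /mix; under eq_bigr do rewrite scalerDr.
exact: big_split.
Qed.

End Averaging.

Lemma doubly_stochastic1 (R : realType) m : doubly_stochastic (1%:M : 'M[R]_m).
Proof.
split=> [i j|i|j]; first by rewrite mxE ler0n.
  rewrite (bigD1 i)//= mxE eqxx big1 ?addr0// => j /negPf ji.
  by rewrite mxE eq_sym ji.
by rewrite (bigD1 j)//= mxE eqxx big1 ?addr0// => i /negPf ij; rewrite mxE ij.
Qed.

Lemma doubly_stochasticM (R : realType) m (A B : 'M[R]_m) :
  doubly_stochastic A -> doubly_stochastic B -> doubly_stochastic (A *m B).
Proof.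
move=> [A0 rA cA] [B0 rB cB]; split=> [i j|i|j].
- by rewrite mxE sumr_ge0// => k _; rewrite mulr_ge0.
- under eq_bigr do rewrite mxE.
  by rewrite exchange_big -(rA i); apply: eq_bigr => k _; rewrite -mulr_sumr rB mulr1.
- under eq_bigr do rewrite mxE.
  by rewrite exchange_big -(cB j); apply: eq_bigr => k _; rewrite -mulr_suml cA mul1r.
Qed.

(** * Products of weight matrices along the network *)

Section Transition.
Context (R : realType) (m : nat) (P : nat -> 'M[R]_m).

Fixpoint transition (s n : nat) : 'M[R]_m :=
  if n is n'.+1 then P (s + n') *m transition s n' else 1%:M.

Section Stochastic.
Hypothesis dsP : forall t, (1 <= t)%N -> doubly_stochastic (P t).

Lemma doubly_stochastic_transition s n :
  (1 <= s)%N -> doubly_stochastic (transition s n).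
Proof.
move=> s1; elim: n => [|n IH] /=; first exact: doubly_stochastic1.
by apply: doubly_stochasticM => //; apply: dsP; rewrite addn_gt0 s1.
Qed.

(** The recursion is linear, so [f (s + n)] is the unperturbed evolution of
    [f s] plus the effect of the perturbations, and each of these adds at most
    [2 * m * c] to the disagreement. *)
Lemma disagreement_perturbed (V : normedModType R) (f e : nat -> 'I_m -> V)
    (c delta : R) s n :
  (forall t, (1 <= t)%N -> f t.+1 = mix (P t) (fun j => f t j + e t j)) ->
  0 <= c -> (forall t j, (1 <= t)%N -> `|e t j| <= c) ->
  (1 <= s)%N -> (forall i j, delta <= transition s n i j) ->
  disagreement (f (s + n)%N) <=
    (1 - m%:R * delta) * disagreement (f s) + n%:R * (2 * m%:R * c).
Proof.
move=> fE c0 ec s1 ld.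
have s1n k : (1 <= s + k)%N by rewrite addn_gt0 s1.
have [r fr rn] : exists2 r : 'I_m -> V,
    f (s + n)%N = (fun i => mix (transition s n) (f s) i + r i) &
    disagreement r <= n%:R * (2 * m%:R * c).
  move: {ld} n; elim=> [|n [r fr rn]].
    exists (fun=> 0).
      by rewrite addn0 mix1; apply/funext => i; rewrite addr0.
    by apply: le_trans (disagreement_le (lexx 0) _) _ => [j|]; rewrite ?normr0 ?mulr0 ?mul0r.
  (* the next remainder: old remainder and new perturbation, mixed together *)
  exists (mix (P (s + n)) (fun j => r j + e (s + n)%N j)).
    rewrite addnS fE// fr /= mixM -mixD; congr mix.
    by apply/funext => j; rewrite addrA.
  rewrite (le_trans (disagreement_mix_le _ (dsP (s1n n))))//.
  rewrite (le_trans (disagreementD _ _))// -natr1 mulrDl mul1r lerD//.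
  exact/disagreement_le/(fun j => ec _ j (s1n n)).
rewrite fr (le_trans (disagreementD _ _))// lerD//.
exact/disagreement_mix/ld/doubly_stochastic_transition.
Qed.

End Stochastic.

Lemma connect_invariant (T : finType) (e : rel T) (A : {pred T}) x y :
  (forall u v, e u v -> u \in A -> v \in A) ->
  connect e x y -> x \in A -> y \in A.
Proof.
move=> inv /connectP[p]; elim: p x => [|z p IH] x /=; first by move=> _ ->.
by move=> /andP[xz zp] yp xA; apply: (IH z zp yp); exact: inv xz xA.
Qed.

Section Connected.
Context (B : nat) (zeta : R).
Hypothesis graphP : graph_assumption P B zeta.
Context (s : nat) (s1 : (1 <= s)%N).

Lemma transition_step n i k j : edge (P (s + n)) k i || (k == i) ->
  zeta ^+ n <= transition s n k j -> zeta ^+ n.+1 <= transition s n.+1 i j.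
Proof.
case: graphP => dsP _ /andP[z0 _] diagP edgeP ki le_k.
have sn1 : (1 <= s + n)%N by rewrite addn_gt0 s1.
have [P0 _ _] := dsP _ sn1.
have [T0 _ _] := doubly_stochastic_transition dsP n s1.
rewrite /= mxE (bigD1 k)//= exprS.
apply: le_trans (_ : P (s + n)%N i k * transition s n k j <= _).
  apply: ler_pM; rewrite ?exprn_ge0 ?(ltW z0)//.
  by case/orP: ki => [/edgeP->//|/eqP->]; exact: diagP.
by rewrite lerDl sumr_ge0// => k' _; rewrite mulr_ge0.
Qed.

(** The nodes to which information emitted by [j] at time [s] has spread after
    [n] steps; the threshold bounds from below the weight of any path of
    [n] edges, self-loops included. *)
Definition reached (j : 'I_m) n : {set 'I_m} :=
  [set i | zeta ^+ n <= transition s n i j].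

Lemma reached_edge j n k i :
  edge (P (s + n)) k i -> k \in reached j n -> i \in reached j n.+1.
Proof. by move=> ki; rewrite !inE; apply: transition_step; rewrite ki. Qed.

Lemma reached_mono j n n' : (n <= n')%N -> reached j n \subset reached j n'.
Proof.
move=> /subnKC <-; elim: (n' - n)%N => [|d IH]; first by rewrite addn0.
rewrite (fintype.subset_trans IH)//; apply/fintype.subsetP => i; rewrite !inE addnS.
by apply: transition_step; rewrite eqxx orbT.
Qed.

(** Any [2 * B] consecutive times contain a whole block
    [k * B + 1, ..., (k + 1) * B]. Over such a block the graph is strongly
    connected, so an edge leaves the reached set unless this set is full. *)
Lemma reached_grow j n : (0 < #|reached j n|)%N ->
  (minn m #|reached j n|.+1 <= #|reached j (n + 2 * B)|)%N.
Proof.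
case: graphP => _ [B1 scP] _ _ _ /card_gt0P[x xn].
have [full|/forallPn[y yn]] := boolP [forall y, y \in reached j n].
  rewrite geq_min (@leq_trans #|reached j n|) ?subset_leq_card ?reached_mono ?leq_addr//.
  by rewrite -[X in (X <= _)%N]card_ord subset_leq_card//; apply/fintype.subsetP => i _; exact: forallP.
(* the index of the first block that starts after time [s + n] *)
set k := ((s + n).-1 %/ B).+1.
have [[u v] /= uv /andP[un vn]] : exists2 p : 'I_m * 'I_m,
    union_edge P B k p.1 p.2 & (p.1 \in reached j n) && (p.2 \notin reached j n).
  apply: contrapT => noedge; move/negP: yn; apply.
  apply: connect_invariant (scP k x y) xn => u v uv un.
  by apply: contrapT => /negP vn; apply: noedge; exists (u, v) => //=; rewrite un vn.
have /hasP[t] := uv; rewrite mem_index_iota => /andP[kt tk] tuv.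
have [lo hi] : (s + n <= t)%N /\ (t < s + n + 2 * B)%N.
  have := divn_eq (s + n).-1 B; have := ltn_pmod (s + n).-1 B1.
  by move: kt tk; rewrite /k !mulSn; lia.
have st : t = (s + (t - s))%N by lia.
have vt : v \in reached j (t - s).+1.
  apply: (reached_edge (k := u)); first by rewrite -st.
  by apply: fintype.subsetP un; apply: reached_mono; lia.
rewrite geq_min; apply/orP; right.
rewrite (_ : #|reached j n|.+1 = #|v |: reached j n|); last by rewrite cardsU1 vn.
apply: subset_leq_card; rewrite finset.subUset finset.sub1set reached_mono ?leq_addr// andbT.
by apply: fintype.subsetP vt; apply: reached_mono; lia.
Qed.

(** The reached set starts with the source and gains a node every [2 * B]
    steps, so it is full after [m] rounds. *)
Lemma transition_lower_bound i j :
  zeta ^+ (m * (2 * B)) <= transition s (m * (2 * B)) i j.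
Proof.
have card_reached k : (minn m k.+1 <= #|reached j (k * (2 * B))|)%N.
  elim: k => [|k IH].
    rewrite geq_min; apply/orP; right; apply/card_gt0P; exists j.
    by rewrite inE /= mxE eqxx.
  rewrite mulSn addnC; have m0 : (0 < m)%N := leq_ltn_trans (leq0n j) (ltn_ord j).
  apply: leq_trans (reached_grow _); last by apply: leq_trans IH; lia.
  by rewrite leq_min geq_minl; move: IH; lia.
have : reached j (m * (2 * B)) == [set: 'I_m]%SET.
  rewrite eqEcard finset.subsetT cardsT card_ord.
  by apply: leq_trans (card_reached m); lia.
by move=> /eqP/finset.setP/(_ i); rewrite !inE.
Qed.

End Connected.
End Transition.

(** Compare the sum with its shift by [W]: the first [W] terms are bounded
    directly, every later one through the term [W] steps before, so the whole
    sum is at most [q] times itself plus the accumulated errors. *)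
Lemma sum_contraction_le (R : realFieldType) (v : nat -> R) (q c : R) (W T : nat) :
  (forall t, 0 <= v t) -> q < 1 ->
  (forall n, (n < W)%N -> v n.+1 <= v 1%N + c) ->
  (forall t, (1 <= t)%N -> v (t + W)%N <= q * v t + c) ->
  \sum_(1 <= t < T.+1) v t <= (W%:R * (v 1%N + c) + T%:R * c) / (1 - q).
Proof.
move=> v0 q1 vstart vstep; rewrite ler_pdivlMr ?subr_gt0//.
set S := \sum_(1 <= t < T.+1) v t.
suff : S <= W%:R * (v 1%N + c) + (q * S + T%:R * c) by lra.
have : S <= \sum_(1 <= t < (W + T).+1) v t.
  rewrite (@big_cat_nat _ _ _ T.+1 1 (W + T).+1)//= ?lerDl ?sumr_ge0//.
  by rewrite ltnS leq_addl.
move=> /le_trans; apply; rewrite (@big_cat_nat _ _ _ W.+1)//= ?ltnS ?leq_addr//.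
apply: lerD.
  rewrite big_add1 /= big_mkord (le_trans (ler_sum _ (fun i _ => vstart _ (ltn_ord i))))//.
  by rewrite sumr_const card_ord mulr_natl.
rewrite -addn1 -addSn [X in \sum_(X <= _ < _) _]addnC big_addn.
rewrite (_ : _ - W = T.+1)%N; last lia.
rewrite mulr_sumr (_ : T%:R * c = \sum_(1 <= t < T.+1) c); last first.
  by rewrite sumr_const_nat subSS subn0 mulr_natl.
rewrite -big_split !big_seq; apply: ler_sum => t; rewrite mem_index_iota => /andP[t1 _].
exact: vstep.
Qed.

(** * Distributed functional gradient descent *)

Section DistributedDescent.
Context (R : realType) (H : completeNormedModType R) (ip : {dot H for idfun}).
Hypothesis Hip : induces_norm ip.
Context (m : nat) (J : 'I_m -> H -> R) (P : nat -> 'M[R]_m) (G L : R).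
Hypothesis m0 : (0 < m)%N.
Hypothesis dsP : forall t, (1 <= t)%N -> doubly_stochastic (P t).
Hypothesis G0 : 0 <= G.
Hypothesis boundG : forall (f : H) (i : 'I_m), `|gradient ip (J i) f| <= G.
Hypothesis L0 : 0 < L.
Hypothesis dJ : forall (i : 'I_m) (f : H), differentiable (J i) f.
Hypothesis smJ : forall i : 'I_m, smooth ip L (J i).

Let D := gradient ip (global_functional J).

Lemma norm_gradient_global_le x : `|D x| <= m%:R * G.
Proof.
rewrite /D (gradient_global Hip dJ smJ) (le_trans (ler_norm_sum _ _ _))//.
rewrite (le_trans (ler_sum _ (fun j _ => boundG x j)))//.
by rewrite sumr_const card_ord mulr_natl.
Qed.

(** The difference of squares factors; one factor is controlled by Lipschitz
    continuity, the other by the uniform bound on the gradients, so the error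
    is linear in [|x - y|] and can be summed with the disagreements. *)
Lemma sqr_norm_gradient_le x y :
  `|D x| ^+ 2 <= `|D y| ^+ 2 + 2 * m%:R ^+ 2 * G * L * `|x - y|.
Proof.
have lip : `|D x - D y| <= m%:R * L * `|x - y|.
  apply: (gradient_lipschitz Hip (differentiable_global dJ)).
    exact: smooth_global.
  by rewrite mulr_gt0// ltr0n.
have xy : `|D x| - `|D y| <= m%:R * L * `|x - y| := le_trans (lerB_dist _ _) lip.
have w0 : 0 <= m%:R * L * `|x - y| := le_trans (normr_ge0 _) lip.
have -> : 2 * m%:R ^+ 2 * G * L * `|x - y| =
    m%:R * L * `|x - y| * (m%:R * G + m%:R * G) by ring.
rewrite -lerBlDl subr_sqr (le_trans (ler_wpM2r _ xy)) ?addr_ge0//.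
by rewrite ler_wpM2l// lerD// norm_gradient_global_le.
Qed.

Section Iterates.
Context (eta : R) (f1 : 'I_m -> H) (f : nat -> 'I_m -> H).
Hypothesis eta0 : 0 <= eta.
Hypothesis dfgd : is_dfgd ip J P eta f1 f.

Let e t j : H := - (eta *: gradient ip (J j) (f t j)).

Let norm_e t j : `|e t j| <= eta * G.
Proof. by rewrite /e normrN normrZ ger0_norm// ler_wpM2l. Qed.

Lemma dfgd_mix t : (1 <= t)%N -> f t.+1 = mix (P t) (fun j => f t j + e t j).
Proof. by move=> t1; apply/funext => i; case: dfgd => _ ->. Qed.

(** The gradient steps are perturbations of size [eta * G] of a pure
    averaging process. *)
Lemma disagreement_dfgd s n delta :
  (1 <= s)%N -> (forall i j, delta <= transition P s n i j) ->
  disagreement (f (s + n)%N) <=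
    (1 - m%:R * delta) * disagreement (f s) + n%:R * (2 * m%:R * (eta * G)).
Proof.
move=> s1 ld; apply: (disagreement_perturbed dsP (e := e)) => //.
- exact: dfgd_mix.
- exact: mulr_ge0.
Qed.

Lemma sum_disagreement_dfgd (W T : nat) (delta : R) :
  (1 <= T)%N -> 0 < delta ->
  (forall s i j, (1 <= s)%N -> delta <= transition P s W i j) ->
  \sum_(1 <= t < T.+1) disagreement (f t) <=
    W%:R * disagreement f1 / (m%:R * delta) +
    2 * W%:R * (W%:R + 1) * G / delta * (eta * T%:R).
Proof.
move=> T1 delta0 ld; set c := W%:R * (2 * m%:R * (eta * G)).
have c0 : 0 <= c by rewrite !mulr_ge0.
have mR0 : 0 < m%:R :> R by rewrite ltr0n.
have f1E : f 1%N = f1 by apply/funext => i; case: dfgd => ->.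
apply: le_trans (sum_contraction_le (q := 1 - m%:R * delta) (c := c) (W := W) T
  _ _ _ _) _.
- by move=> t; exact: disagreement_ge0.
- by rewrite ltrBlDr ltrDl mulr_gt0.
- move=> n nW; rewrite -add1n.
  (* within the first window the weights are only known to be nonnegative *)
  apply: le_trans (disagreement_dfgd (delta := 0) _ _) _ => //.
    by have [] := doubly_stochastic_transition dsP n (leqnn 1).
  rewrite mulr0 subr0 mul1r lerD2l /c ler_wpM2r ?ler_nat ?(ltnW nW)//.
  by rewrite !mulr_ge0.
- by move=> t t1; apply: disagreement_dfgd => // i j; exact: ld.
rewrite f1E subKr.
rewrite (_ : W%:R * disagreement f1 / (m%:R * delta) + _ =
  (W%:R * disagreement f1 + T%:R * (W%:R + 1) * c) / (m%:R * delta)); last first.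
  by rewrite /c; field; rewrite (gt_eqF mR0) (gt_eqF delta0).
rewrite ler_pM2r ?invr_gt0 ?mulr_gt0// mulrDr -addrA lerD2l.
rewrite mulrDr mulr1 mulrDl lerD2r ler_wpM2r// ler_peMl// ler1n//.
Qed.

(** The mean performs gradient descent on the global functional with step
    [eta / m], except that each local gradient is taken at the node's own
    iterate; Lipschitz continuity bounds that error by the disagreement. *)
Lemma mean_descent t : (1 <= t)%N ->
  eta / m%:R * `|D (mean (f t))| ^+ 2 <=
    global_functional J (mean (f t)) - global_functional J (mean (f t.+1)) +
    (G * L * eta * disagreement (f t) + m%:R * L * G ^+ 2 / 2 * eta ^+ 2).
Proof.
move=> t1; set x := mean (f t).
have mR0 : 0 < m%:R :> R by rewrite ltr0n.
set g := \sum_(j < m) gradient ip (J j) (f t j).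
have stepE : mean (f t.+1) - x = mean (e t).
  apply/eqP; rewrite subr_eq addrC dfgd_mix// (mean_mix _ (dsP t1)).
  exact/eqP/meanD.
have meanE : mean (e t) = - (eta / m%:R *: g).
  by rewrite /mean /e sumrN -scaler_sumr scalerN scalerA mulrC.
have gD : `|g - D x| <= L * disagreement (f t).
  rewrite /D (gradient_global Hip dJ smJ) /g -sumrB (le_trans (ler_norm_sum _ _ _))//.
  rewrite /disagreement mulr_sumr; apply: ler_sum => j _.
  exact: (gradient_lipschitz Hip (dJ j)).
have := gradient_upper Hip (differentiable_global dJ) (smooth_global Hip dJ smJ)
  (mean (f t.+1)) x.
rewrite stepE; have : `|mean (e t)| <= eta * G.
  by apply: norm_mean_le => //; rewrite mulr_ge0.
rewrite {2}meanE (ipNl ip) (ipZl ip) -/D.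
have : `|D x| ^+ 2 - ip g (D x) <= m%:R * G * (L * disagreement (f t)).
  rewrite -(ipxx Hip) -(ipNl ip) -(ipDl ip) (le_trans (ip_le Hip _ _))//.
  by rewrite distrC mulrC ler_pM// norm_gradient_global_le.
move: (normr_ge0 (mean (e t))).
move: (global_functional J _) (global_functional J x) => Fy Fx.
move: (ip g _) (`|mean (e t)|) (`|D x| ^+ 2) (disagreement _) => p n d V.
move=> n0 hp hn up.
have h1 : m%:R * L / 2 * n ^+ 2 <= m%:R * L / 2 * (eta * G) ^+ 2.
  by rewrite ler_wpM2l ?mulr_ge0 ?(ltW mR0) ?(ltW L0)// lerXn2r ?nnegrE// (le_trans n0).
have h2 : eta / m%:R * (d - p) <= eta / m%:R * (m%:R * G * (L * V)).
  by rewrite ler_wpM2l// divr_ge0.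
have h3 : eta / m%:R * (m%:R * G * (L * V)) = G * L * eta * V.
  by field; rewrite gt_eqF.
rewrite exprMn in h1; lra.
Qed.

Lemma sum_gradient_mean_le T (Jmin : R) :
  (forall x, Jmin <= global_functional J x) ->
  eta / m%:R * \sum_(1 <= t < T.+1) `|D (mean (f t))| ^+ 2 <=
    global_functional J (mean f1) - Jmin +
    (G * L * eta * \sum_(1 <= t < T.+1) disagreement (f t)
     + m%:R * L * G ^+ 2 / 2 * eta ^+ 2 * T%:R).
Proof.
move=> Jmin_le; have f1E : f 1%N = f1 by apply/funext => i; case: dfgd => ->.
set F := fun t => global_functional J (mean (f t)).
apply: (@le_trans _ _ (\sum_(1 <= t < T.+1) (- (F t.+1 - F t) +
    (G * L * eta * disagreement (f t) + m%:R * L * G ^+ 2 / 2 * eta ^+ 2)))).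
  rewrite mulr_sumr; apply: ler_sum_nat => t /andP[t1 _].
  by rewrite opprB; exact: mean_descent.
rewrite !big_split sumrN telescope_sumr// opprB /= -mulr_sumr /F f1E lerD//.
  by rewrite lerB.
by rewrite sumr_const_nat subSS subn0 mulr_natr.
Qed.


End Iterates.

(** The rate: with [u = sqrt (T + 3)] between [sqrt T] and [2 * sqrt T], the
    initial gap is divided by [eta * T], of order [sqrt T], and every other
    term carries a factor [eta] or [1 / T]. *)
Lemma rate_arith (T : nat) (Q S A M N K1 K2 : R) : (1 <= T)%N ->
  0 <= A -> 0 <= M -> 0 <= N -> 0 <= K1 -> 0 <= K2 ->
  Q <= A / stepsize L T + M * S + N * (stepsize L T * T%:R) ->
  S <= K1 + K2 * (stepsize L T * T%:R) ->
  T%:R^-1 * Q <=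
    (4 * L * A + M * (K1 + K2 / (2 * L)) + N / (2 * L)) / Num.sqrt T%:R.
Proof.
move=> T1 A0 M0 N0 K10 K20.
set r : R := Num.sqrt T%:R; set u : R := Num.sqrt (T + 3)%:R.
have r1 : 1 <= r by rewrite -sqrtr1 ler_wsqrtr// ler1n.
have r2 : r ^+ 2 = T%:R by rewrite sqr_sqrtr.
have ru : r <= u by rewrite ler_wsqrtr// ler_nat leq_addr.
have ur : u <= 2 * r.
  rewrite -(@ler_pXn2r _ 2)// ?nnegrE ?mulr_ge0 ?sqrtr_ge0// exprMn r2 sqr_sqrtr//.
  by rewrite -natrX -natrM ler_nat; lia.
have r0 : 0 < r := lt_le_trans ltr01 r1.
have u0 : 0 < u := lt_le_trans r0 ru.
have etaT : stepsize L T * T%:R <= r / (2 * L).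
  rewrite /stepsize -/u -r2 mulrC ler_pdivrMr ?mulr_gt0//.
  rewrite (_ : r / (2 * L) * (2 * L * u) = r * u); last by field; rewrite gt_eqF.
  by rewrite expr2 ler_wpM2l// ltW.
have Aeta : A / stepsize L T <= r * (4 * L * A).
  rewrite /stepsize -/u invrK (_ : r * _ = A * (2 * L * (2 * r))); last ring.
  by rewrite ler_wpM2l// ler_wpM2l// mulr_ge0// ltW.
move: etaT Aeta; move: (stepsize L T * T%:R) (A / stepsize L T) => w a wr ar hQ hS.
rewrite -r2 mulrC ler_pdivrMr ?exprn_gt0//.
rewrite [leRHS](_ : _ = r * (4 * L * A) + (M * (r * K1 + K2 * (r / (2 * L)))
   + N * (r / (2 * L)))); last by field; rewrite !gt_eqF.
rewrite (le_trans hQ)// -addrA lerD// lerD ?ler_wpM2l//.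
by rewrite (le_trans hS)// lerD ?ler_wpM2l// ler_peMl.
Qed.

(** The constants depend on the network, on the functionals and on [f1] only,
    so they can be chosen before [T] and the iterates, although the stepsize,
    hence the whole trajectory, changes with [T]. *)
Lemma gradient_rate (B : nat) (zeta Jmin : R) (f1 : 'I_m -> H) (l : 'I_m) :
  graph_assumption P B zeta ->
  (forall x, Jmin <= global_functional J x) ->
  exists2 C : R, 0 < C &
    forall (T : nat) (f : nat -> 'I_m -> H), (1 <= T)%N ->
    is_dfgd ip J P (stepsize L T) f1 f ->
    T%:R^-1 * \sum_(1 <= t < T.+1) `|D (f t l)| ^+ 2 <= C / Num.sqrt T%:R.
Proof.
move=> graphP Jmin_le; have [_ _ /andP[z0 _] _ _] := graphP.
have mR0 : 0 < m%:R :> R by rewrite ltr0n.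
set W := (m * (2 * B))%N; set delta := zeta ^+ W.
have delta0 : 0 < delta by rewrite exprn_gt0.
set A := m%:R * (global_functional J (mean f1) - Jmin).
set M := m%:R * G * L + 2 * m%:R ^+ 2 * G * L.
set N := m%:R ^+ 2 * L * G ^+ 2 / 2.
set K1 := W%:R * disagreement f1 / (m%:R * delta).
set K2 := 2 * W%:R * (W%:R + 1) * G / delta.
have lL := ltW L0; have lz := ltW z0; have ld := ltW delta0.
have A0 : 0 <= A by rewrite mulr_ge0// subr_ge0.
have M0 : 0 <= M by rewrite addr_ge0 ?mulr_ge0 ?exprn_ge0.
have N0 : 0 <= N by rewrite !mulr_ge0 ?exprn_ge0 ?invr_ge0.
have K10 : 0 <= K1 by rewrite divr_ge0 ?mulr_ge0 ?disagreement_ge0.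
have K20 : 0 <= K2 by rewrite divr_ge0 ?mulr_ge0 ?addr_ge0.
set C := 4 * L * A + M * (K1 + K2 / (2 * L)) + N / (2 * L).
have C0 : 0 <= C.
  have tL0 : 0 <= 2 * L by rewrite mulr_ge0.
  have := divr_ge0 K20 tL0; have := divr_ge0 N0 tL0 => NL0 KL0.
  by rewrite /C addr_ge0// addr_ge0// mulr_ge0// ?mulr_ge0 ?addr_ge0.
(* [C] vanishes in degenerate cases and the constant has to be positive *)
exists (C + 1) => [|T f T1 dfgd]; first by rewrite ltr_wpDl.
have eta0 : 0 < stepsize L T.
  by rewrite invr_gt0 !mulr_gt0 ?sqrtr_gt0 ?ltr0n ?addn_gt0 ?orbT.
apply: (@le_trans _ _ (C / Num.sqrt T%:R)); last first.
  by rewrite ler_wpM2r ?invr_ge0 ?sqrtr_ge0// lerDl.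
apply: (rate_arith (S := \sum_(1 <= t < T.+1) disagreement (f t))) => //; last first.
  apply: (sum_disagreement_dfgd (ltW eta0) dfgd T1 delta0) => s i j s1.
  exact: (transition_lower_bound graphP).
set S := \sum_(1 <= t < T.+1) disagreement (f t).
apply: (@le_trans _ _ (\sum_(1 <= t < T.+1) `|D (mean (f t))| ^+ 2 +
    2 * m%:R ^+ 2 * G * L * S)).
  rewrite /S mulr_sumr -big_split; apply: ler_sum => t _ /=.
  rewrite (le_trans (sqr_norm_gradient_le _ (mean (f t))))// lerD2l.
  by rewrite ler_wpM2l ?norm_sub_mean_le// !mulr_ge0 ?exprn_ge0.
have := sum_gradient_mean_le (ltW eta0) dfgd T Jmin_le.
rewrite mulrAC ler_pdivrMr// mulrC -ler_pdivlMr// -/S.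
move: (\sum_(1 <= t < T.+1) _) S => Q S hQ.
apply: le_trans (lerD hQ (lexx _)) _; rewrite le_eqVlt; apply/orP; left; apply/eqP.
by rewrite /A /M /N; field; rewrite gt_eqF.
Qed.

End DistributedDescent.

Unset Implicit Arguments.

Theorem theorem2 (R : realType) (H : completeNormedModType R)
    (ip : {dot H for idfun}) (Hip : induces_norm ip)
    (m : nat) (J : 'I_m -> H -> R)
    (fstar : H)
    (Hfstar : forall f : H, global_functional J fstar <= global_functional J f)
    (P : nat -> 'M[R]_m) (B : nat) (zeta : R)
    (Hgraph : graph_assumption P B zeta)
    (G : R)
    (HG : forall (f : H) (i : 'I_m), `|gradient ip (J i) f| <= G)
    (L : R) (HL : 0 < L)
    (Hdiff : forall (i : 'I_m) (f : H), differentiable (J i) f)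
    (Hsmooth : forall i : 'I_m, smooth ip L (J i))
    (f1 : 'I_m -> H) :
  (forall l : 'I_m, exists2 C : R, 0 < C &
     forall (T : nat) (f : nat -> 'I_m -> H), (1 <= T)%N ->
       is_dfgd ip J P (stepsize L T) f1 f ->
       T%:R^-1 * \sum_(1 <= t < T.+1)
                   `|gradient ip (global_functional J) (f t l)| ^+ 2
         <= C / Num.sqrt T%:R)
  /\
  (forall mu : R, 0 < mu ->
     polyak_lojasiewicz ip mu (global_functional J) fstar ->
     forall l : 'I_m, exists2 C : R, 0 < C &
     forall (T : nat) (f : nat -> 'I_m -> H), (1 <= T)%N ->
       is_dfgd ip J P (stepsize L T) f1 f ->
       T%:R^-1 * \sum_(1 <= t < T.+1)
                   (global_functional J (f t l) - global_functional J fstar)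
         <= C / Num.sqrt T%:R).
Proof.
have rate l : exists2 C : R, 0 < C &
    forall (T : nat) (f : nat -> 'I_m -> H), (1 <= T)%N ->
      is_dfgd ip J P (stepsize L T) f1 f ->
      T%:R^-1 * \sum_(1 <= t < T.+1)
        `|gradient ip (global_functional J) (f t l)| ^+ 2 <= C / Num.sqrt T%:R.
  have [dsP _ _ _ _] := Hgraph.
  have m0 : (0 < m)%N := leq_ltn_trans (leq0n l) (ltn_ord l).
  have G0 : 0 <= G := le_trans (normr_ge0 _) (HG 0 l).
  exact: (gradient_rate Hip m0 dsP G0 HG HL Hdiff Hsmooth f1 l Hgraph Hfstar).
split=> // mu mu0 PL l; have [C C0 rateC] := rate l.
exists (C / (2 * mu)) => [|T f T1 dfgd]; first by rewrite divr_gt0// mulr_gt0.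
rewrite mulrAC ler_pdivlMr ?mulr_gt0//.
apply: le_trans (rateC T f T1 dfgd); rewrite -mulrA ler_wpM2l ?invr_ge0//.
rewrite mulr_suml; apply: ler_sum => t _.
by have := PL (f t l); lra.
Qed.
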